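(* $\preccurlyeq_2^p \leq_B \preccurlyeq_2^{tree}\restriction\Lambda(2)$. Consequently $\preccurlyeq_2^{tree}$ (on the space $Tr(2)$ of all trees on $2=\{0,1\}$) is a universal countable Borel quasi-order.
   Context: A countable Borel quasi-order is a Borel quasi-order $Q$ on a standard Borel space such that every set of predecessors $\{y: y\mathbin{Q}x\}$ is countable; $Q\leq_B Q'$ means there is a Borel map $f$ with $x\mathbin{Q}y\Leftrightarrow f(x)\mathbin{Q'}f(y)$, and a countable Borel quasi-order is universal if every countable Borel quasi-order Borel reduces to it. For a countable discrete set $X$, a tree on $X$ is a nonempty subset $T\subseteq X^{<\mathbb{N}}$ closed under initial segments; $Tr(X)$ is the Polish space of trees on $X$ (as a closed subset of $2^{X^{<\mathbb{N}}}$), and $\Lambda(X)$ is the Borel set of infinite trees. For $u\in X^{<\mathbb{N}}$, $T_u=\{v : u^\frown v\in T\}$, and $T\preccurlyeq_X^{tree}T'$ iff there is $u\in X^{<\mathbb{N}}$ with $T=T'_u$. $M_2$ is the free monoid on two generators $a,b$; on $\mathcal P(M_2)\cong 2^{M_2}$ the quasi-order $\preccurlyeq_2^p$ is defined by $A\preccurlyeq_2^p B$ iff there is $m\in M_2$ with $mA=B\cap mM_2$. *)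

(* Defs.v *)
From mathcomp Require Import all_boot all_order all_algebra.
From mathcomp Require Import all_classical all_reals all_analysis.

Set Implicit Arguments.
Unset Strict Implicit.
Unset Printing Implicit Defensive.

Local Open Scope classical_set_scope.

(* Completeness is not stated with [Complete] because the library's complete
   spaces are pointed, whereas a Polish space may be empty. *)
Definition polish (R : realType) (P : metricType R) : Prop :=
  (exists2 S : set P, countable S & dense S) /\
  (forall F : set_system P, ProperFilter F -> cauchy F ->
     exists l : P, F --> l).

(* Spaces are represented by a set D in a measurable type T, with the trace
   sigma-algebra; as measurable types are pointed, this is also what makes room
   for the empty space.  [standard_borel D] says that (D, trace) is isomorphic,
   through g, to a Polish space with its Borel sigma-algebra.  [measurable D]
   is required because [measurable_fun D f] holds vacuously otherwise; it
   excludes no space up to isomorphism (take D := setT or D := set0). *)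
Definition standard_borel (R : realType) (d : measure_display)
    (T : measurableType d) (D : set T) : Prop :=
  measurable D /\
  exists (P : metricType R) (g : P -> T),
    [/\ polish P, set_bij [set: P] D g
      & <<s @open P >> = preimage_set_system [set: P] g (@measurable d T)].

Definition quasi_order (T : Type) (D : set T) (Q : T -> T -> Prop) : Prop :=
  (forall x, D x -> Q x x) /\
  (forall x y z, D x -> D y -> D z -> Q x y -> Q y z -> Q x z).

(* On D `*` D, the product of the traces is the trace of the product, so since
   D is measurable, Borel subsets of D `*` D are those measurable in T * T. *)
Definition countable_borel_quasi_order (R : realType) (d : measure_display)
    (T : measurableType d) (D : set T) (Q : T -> T -> Prop) : Prop :=
  [/\ standard_borel R D,
      quasi_order D Q,
      measurable [set xy : T * T | [/\ D xy.1, D xy.2 & Q xy.1 xy.2]]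
    & forall x, D x -> countable [set y | D y /\ Q y x]].

Definition borel_reducible (d d' : measure_display)
    (T : measurableType d) (D : set T) (Q : T -> T -> Prop)
    (T' : measurableType d') (D' : set T') (Q' : T' -> T' -> Prop) : Prop :=
  exists f : T -> T',
    [/\ measurable_fun D f,
        set_fun D D' f
      & forall x y, D x -> D y -> (Q x y <-> Q' (f x) (f y))].

Definition universal_countable_borel_quasi_order (R : realType)
    (d : measure_display) (T : measurableType d) (D : set T)
    (Q : T -> T -> Prop) : Prop :=
  countable_borel_quasi_order R D Q /\
  forall (d' : measure_display) (T' : measurableType d') (D' : set T')
         (Q' : T' -> T' -> Prop),
    countable_borel_quasi_order R D' Q' -> borel_reducible D' Q' D Q.

(* 2^I with the Borel sigma-algebra of the product topology, 2 being discrete;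
   a point is the indicator function of a subset of I. *)
Definition power2 (I : Type) :=
  g_sigma_algebraType (@open (prod_topology (fun _ : I => bool))).

Definition Tr (X : countType) : set (power2 (seq X)) :=
  [set T | (exists u, T u) /\ (forall u v, prefix u v -> T v -> T u)].
Arguments Tr : clear implicits.

Definition Lambda (X : countType) : set (power2 (seq X)) :=
  Tr X `&` [set T | infinite_set [set u | T u]].
Arguments Lambda : clear implicits.

(* T_u; it is empty, hence not a tree, when u is not in T. *)
Definition subtree_at (X : countType) (T : power2 (seq X)) (u : seq X) :
    power2 (seq X) :=
  fun v => T (u ++ v).

Definition tree_le (X : countType) (T T' : power2 (seq X)) : Prop :=
  exists u : seq X, T = subtree_at T' u.

(* The free monoid on two generators (a and b being the one-letter words false
   and true); its product is concatenation. *)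
Definition M2 : Type := seq bool.

Definition p2_le (A B : power2 M2) : Prop :=
  exists m : M2,
    [set m ++ w | w in [set w | A w]] = [set w | B w] `&` range (cat m).

(* Main.v *)
Require Import Defs.
From HB Require Import structures.
From mathcomp Require Import all_boot all_order all_algebra.
From mathcomp Require Import all_classical all_reals all_analysis.
From mathcomp Require Import lra.

(* For subsets A, B of M_2, [p2_le A B] says that A is B shifted by some word m.
   Coding each letter b by the two letters 0b, and hanging a leaf 1 at the code
   of each word of A, turns A into an infinite tree T_A whose translates that
   are of the form T_B are exactly those at codes of words.

   For universality, let Q be a countable Borel quasi-order, transported to a
   Borel subset of the Cantor space.  A weak form of the Lusin-Novikov theorem
   gives Borel functions g_n, defined everywhere, with
   [Q y x <-> exists n, y = g_n x]; then x is sent to the set of words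
   describing the bits of g_w x for all compositions g_w of the g_n.

   To get the g_n, write the relation P as the projection of a closed set F.
   Call a finite family of basic neighbourhoods in F negligible when, off
   countably many Borel graphs, no x lies in the projection of all of them.
   As there are only countably many families, all the negligible ones can be
   dealt with by the same graphs.  If a non-negligible family could not be
   refined by splitting one of its members t in two, the points of t over the
   remaining x would form an analytic set with at most one point in each
   section; by Lusin separation such a set is contained in a Borel graph, so
   the family would be negligible after all.  Hence if P is not covered by
   countably many Borel graphs, iterated splitting yields a Cantor set in a
   single section of P. *)

Set Implicit Arguments.
Unset Strict Implicit.
Unset Printing Implicit Defensive.

Import Order.TTheory GRing.Theory Num.Theory.
Local Open Scope classical_set_scope.

(** * The Borel sets of 2^I *)

(** The cylinders around x over finite sets of coordinates generate a filter converging to x in each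
    coordinate, hence in the product; conversely a cylinder is a finite intersection of coordinate
    neighbourhoods. *)
Lemma open_power2P (I : eqType) (U : set (prod_topology (fun _ : I => bool))) :
  open U <-> forall x, U x ->
    exists s : seq I, forall y, (forall i, i \in s -> y i = x i) -> U y.
Proof.
split.
  move=> oU x Ux.
  pose F := filter_from [set: seq I]
    (fun s => [set y : prod_topology (fun _ : I => bool) | forall i, i \in s -> y i = x i]).
  have FF : Filter F.
    apply: filter_from_filter; first by exists [::].
    move=> s t _ _; exists (s ++ t) => // y ye; split=> i si; apply: ye;
      by rewrite mem_cat si ?orbT.
  have Fx : F --> (x : prod_topology (fun _ : I => bool)).
    apply/cvg_sup => i A.
    rewrite nbhsE => -[B [oB Bx] BA]; have [Z oZ ZB] := oB.
    exists [:: i] => //= y yi; apply: BA; rewrite -ZB /=.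
    by rewrite yi ?mem_head//; rewrite -ZB in Bx.
  have [|s _ sU] := Fx U; first exact: open_nbhs_nbhs.
  by exists s.
move=> H; rewrite openE => x Ux; have [s sU] := H x Ux.
rewrite /interior.
have : nbhs x [set y : prod_topology (fun _ : I => bool) |
    forall i, i \in s -> y i = x i].
  elim: s {sU} => [|i s IH]; first by apply: filterE => y /=.
  have Hi : nbhs x [set y : prod_topology (fun _ : I => bool) | y i = x i].
    have /cvg_sup/(_ i) : x --> x by apply: cvg_id.
    apply; apply: open_nbhs_nbhs; split => //.
    by exists [set x i] => //; exact: discrete_open.
  by apply: filterS (filterI Hi IH) => y [yi ys] j; rewrite inE => /orP[/eqP->//|/ys].
by apply: filterS => y; exact: sU.
Qed.

Lemma measurable_coord (I : eqType) (i : I) (b : bool) :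
  measurable ([set x : power2 I | x i = b] : set (power2 I)).
Proof.
apply: sub_sigma_algebra; apply/open_power2P => x /= xi.
by exists [:: i] => y -> //; rewrite mem_head.
Qed.

(** An open set is the union of the cylinders inside it, and as [I] is countable there are only
    countably many cylinders; so the coordinate sets generate the Borel sets. *)
Lemma power2_sigma_algebra_ind (I : countType) (G : set (set (power2 I))) :
  sigma_algebra setT G -> (forall i, G [set x | x i]) ->
  forall A : set (power2 I), measurable A -> G A.
Proof.
move=> sG Gi A mA; apply: mA; split=> //= U; rewrite -/(open _) => /open_power2P oU.
have [G0 GC GU] := sG.
have GC' B : G B -> G (~` B) by move=> /GC; rewrite setTD.
have GT : G setT by rewrite -setC0; exact: GC'.
have GU2 B C : G B -> G C -> G (B `|` C).
  by move=> GB GC2; rewrite -bigcup2E; apply: GU => -[|[|n]].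
have GI2 B C : G B -> G C -> G (B `&` C).
  by move=> GB GC2; rewrite -[_ `&` _]setCK setCI; apply/GC'/GU2; exact: GC'.
pose cyl (c : seq (I * bool)) : set (power2 I) := [set y | forall ib, ib \in c -> y ib.1 = ib.2].
have Gcyl c : G (cyl c).
  elim: c => [|[i b] c IH].
    by rewrite (_ : cyl _ = setT)// -subTset => y _ ib.
  rewrite (_ : cyl _ = [set y | y i = b] `&` cyl c).
    apply: GI2 => //; case: b; first exact: Gi.
    rewrite (_ : [set _ | _] = ~` [set x : power2 I | x i]); first exact: (GC' _ (Gi i)).
    by apply/seteqP; split=> y /=; case: (y i).
  apply/seteqP; split=> y /=.
    move=> H; split=> [|jb jc]; first by apply: (H (i, b)); rewrite mem_head.
    by apply: H; rewrite inE jc orbT.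
  by move=> [yi yc] jb; rewrite inE => /orP[/eqP->//|/yc].
(* [H] enumerates all cylinders, with those not contained in [U] replaced by the empty set. *)
pose H n : set (power2 I) :=
  if unpickle n is Some c then (if `[< cyl c `<=` U >] then cyl c else set0) else set0.
rewrite (_ : U = \bigcup_n H n).
  by apply: GU => n; rewrite /H; case: unpickle => // c; case: ifP.
apply/seteqP; split=> x.
  move=> Ux; have [s sU] := oU x Ux.
  exists (pickle [seq (i, x i) | i <- s]) => //; rewrite /H pickleK.
  have -> : `[< cyl [seq (i, x i) | i <- s] `<=` U >].
    apply/asboolP => y ye; apply: sU => i si.
    by apply: (ye (i, x i)); apply: map_f.
  by move=> ib /mapP [i _ ->].
by move=> [n _]; rewrite /H; case: unpickle => // c; case: ifPn => // /asboolP; apply.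
Qed.

Lemma measurable_fun_power2 (I : countType) d (T : measurableType d) (D : set T)
    (f : T -> power2 I) :
  measurable D -> (forall i, measurable (D `&` [set t | f t i])) -> measurable_fun D f.
Proof.
move=> mD mf _ B.
apply: (power2_sigma_algebra_ind (G := [set B | measurable (D `&` f @^-1` B)])) => //.
split=> /=.
- by rewrite preimage_set0 setI0.
- move=> A mA; rewrite setTD preimage_setC -setDE.
  by rewrite -[_ `\` _]set0U -(setDv D) -setDIr; exact: measurableD.
- by move=> A mA; rewrite preimage_bigcup setI_bigcupr; exact: bigcupT_measurable.
Qed.

(** * Borel sets defined by formulas with countable quantifiers *)

Section measurable_formulas.
Context d (T : measurableType d).
Implicit Types p q : T -> Prop.

Lemma measurable_set_exists (I : countType) (p : I -> T -> Prop) :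
  (forall i, measurable [set x | p i x]) -> measurable [set x | exists i, p i x].
Proof.
move=> mp; rewrite (_ : [set _ | _] = \bigcup_i [set x | p i x]).
  by apply: countable_bigcupT_measurable => //; exact: countableP.
by apply/seteqP; split=> x /= [i]; [exists i|move=> _ ?; exists i].
Qed.

Lemma measurable_set_not p : measurable [set x | p x] -> measurable [set x | ~ p x].
Proof. exact: measurableC. Qed.

Lemma measurable_set_forall (I : countType) (p : I -> T -> Prop) :
  (forall i, measurable [set x | p i x]) -> measurable [set x | forall i, p i x].
Proof.
move=> mp; rewrite (_ : [set _ | _] = ~` [set x | exists i, ~ p i x]).
  by apply/measurableC/measurable_set_exists => i; exact: measurable_set_not.
by apply/seteqP; split=> x /=; [move=> H [i]; apply|move=> /forallNP H i; exact: contrapT].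
Qed.

Lemma measurable_set_and p q : measurable [set x | p x] -> measurable [set x | q x] ->
  measurable [set x | p x /\ q x].
Proof. exact: measurableI. Qed.

Lemma measurable_set_imply p q : measurable [set x | p x] -> measurable [set x | q x] ->
  measurable [set x | p x -> q x].
Proof.
move=> mp mq; rewrite (_ : [set _ | _] = ~` [set x | p x] `|` [set x | q x]).
  by apply: measurableU => //; exact: measurableC.
apply/seteqP; split=> x /=; last by move=> [].
by have [px /(_ px)|] := pselect (p x); [right|left].
Qed.

Lemma measurable_set_prop (P : Prop) : measurable [set _ : T | P].
Proof.
have [HP|nP] := pselect P.
  by rewrite (_ : [set _ | _] = setT)//; apply/seteqP; split.
by rewrite (_ : [set _ | _] = set0)//; apply/seteqP; split.
Qed.

End measurable_formulas.

(** * Analytic sets *)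

Definition agree (T : Type) (n : nat) (f g : nat -> T) :=
  forall i, (i < n)%N -> f i = g i.

(* Closed in the product of discrete topologies. *)
Definition tree_closed (T : Type) (F : set (nat -> T)) :=
  forall f, (forall n, exists2 g, F g & agree n f g) -> F f.

Definition fpair (V W : Type) (x : nat -> V) (z : nat -> W) : nat -> V * W :=
  fun n => (x n, z n).

Lemma fpairK (V W : Type) (f : nat -> V * W) : fpair (fst \o f) (snd \o f) = f.
Proof. by apply/funext => n; rewrite /fpair /=; case: (f n). Qed.

Definition initseg (T : Type) (s : seq T) : set (nat -> T) :=
  [set f | mkseq f (size s) = s].

Lemma eq_mkseqP (T : Type) (f g : nat -> T) n :
  mkseq f n = mkseq g n <-> agree n f g.
Proof.
elim: n => [|n IH]; first by split.
rewrite !mkseqS; split.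
  move/rcons_inj => -[/IH fg fgn] i; rewrite ltnS leq_eqVlt => /orP[/eqP->//|].
  exact: fg.
by move=> fg; rewrite fg// (IH.2 _)// => i /ltnW; exact: fg.
Qed.

Lemma initseg_mkseqP (T : Type) (f g : nat -> T) n :
  initseg (mkseq f n) g <-> agree n g f.
Proof. by rewrite -eq_mkseqP /initseg /mkset size_mkseq. Qed.

Lemma initseg_mkseq (T : Type) (f : nat -> T) n : initseg (mkseq f n) f.
Proof. by rewrite /initseg /= size_mkseq. Qed.

Lemma tree_closed_initseg (T : Type) (s : seq T) (F : set (nat -> T)) :
  tree_closed F -> tree_closed (F `&` initseg s).
Proof.
move=> cF f H; split.
  by apply: cF => n; have [g [Fg _] fg] := H n; exists g.
have [g [_ sg] fg] := H (size s).
by rewrite /initseg/= (eq_mkseqP f g (size s)).2.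
Qed.

Lemma tree_closed_map (T U : Type) (e : T -> U) (F : set (nat -> T)) :
  injective e -> tree_closed F -> tree_closed [set e \o h | h in F].
Proof.
move=> inje cF f H.
have /choice [h hP] : forall n, exists t, f n = e t.
  by move=> n; have [_ [h _ <-] fg] := H n.+1; exists (h n); exact: fg.
exists h; last by apply/funext => n /=.
apply: cF => n; have [_ [h' Fh' <-] fg] := H n.
by exists h' => // i /fg /=; rewrite hP => /inje.
Qed.

(** Projections of closed sets along the Baire space; the point and its witness are read in parallel
    as one sequence of pairs. *)
Definition analytic (V : Type) (A : set (nat -> V)) :=
  exists2 F : set (nat -> V * nat), tree_closed F &
    forall x, A x <-> exists z, F (fpair x z).

Definition finitary (V : Type) (A : set (nat -> V)) :=
  exists n, forall x y, agree n x y -> A x -> A y.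

Lemma agree_sym (T : Type) n (f g : nat -> T) : agree n f g -> agree n g f.
Proof. by move=> fg i /fg. Qed.

Lemma agree_le (T : Type) m n (f g : nat -> T) :
  (m <= n)%N -> agree n f g -> agree m f g.
Proof. by move=> mn fg i im; apply: fg; exact: leq_trans mn. Qed.

Lemma finitaryC (V : Type) (A : set (nat -> V)) : finitary A -> finitary (~` A).
Proof.
by move=> [n H]; exists n => x y xy nAx Ay; apply: nAx; exact: H (agree_sym xy) Ay.
Qed.

Lemma finitary_analytic (V : Type) (A : set (nat -> V)) : finitary A -> analytic A.
Proof.
move=> [n H]; exists [set f | A (fst \o f)].
  move=> f /(_ n)[g /= Ag fg]; apply: H Ag => i /fg /=.
  by rewrite /comp => ->.
by move=> x; split=> [Ax|[z]//]; exists (fun=> 0%N).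
Qed.

Lemma analytic_choice (V : Type) (A : nat -> set (nat -> V)) :
  (forall k, analytic (A k)) -> exists F : nat -> set (nat -> V * nat),
    forall k, tree_closed (F k) /\ forall x, A k x <-> exists z, F k (fpair x z).
Proof.
move=> aA; have /choice[F FP] k : exists F : set (nat -> V * nat),
    tree_closed F /\ forall x, A k x <-> exists z, F (fpair x z).
  by have [F] := aA k; exists F.
by exists F.
Qed.

Lemma analytic_bigcup (V : Type) (A : nat -> set (nat -> V)) :
  (forall k, analytic (A k)) -> analytic (\bigcup_k A k).
Proof.
move=> /analytic_choice[F FP].
(* The first entry of the new witness names the index k; the rest is a witness for [A k], shifted by
   one place. *)
exists [set f | F (f 0%N).2 (fpair (fst \o f) (fun n => (f n.+1).2))].
  move=> f H; apply: (FP _).1 => n.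
  have [g /= Fg fg] := H n.+1.
  exists (fpair (fst \o g) (fun n => (g n.+1).2)); first by rewrite fg.
  by move=> i lin; rewrite /fpair /= !fg// ltnW.
move=> x; split.
  move=> [k _ /(FP k).2 [z Fz]].
  by exists (fun n => if n is n'.+1 then z n' else k).
by move=> [z Fz]; exists (z 0%N) => //; apply/(FP _).2; exists (fun n => z n.+1).
Qed.

Lemma analytic_bigcap (V : Type) (A : nat -> set (nat -> V)) :
  (forall k, analytic (A k)) -> analytic (\bigcap_k A k).
Proof.
move=> /analytic_choice[F FP].
(* A single witness carries countably many, interleaved by the pairing of k and n. *)
pose c (k : nat) (z : nat -> nat) (n : nat) := z (pickle (k, n)).
exists [set f | forall k, F k (fpair (fst \o f) (c k (snd \o f)))].
  move=> f H k; apply: (FP _).1 => n.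
  (* [N] bounds n and every position from which the first n entries of the k-th witness are read. *)
  pose N := (n + \sum_(i < n) (pickle (k, i : nat)).+1)%N.
  have [g /= Fg fg] := H N.
  exists (fpair (fst \o g) (c k (snd \o g))) => // i lin.
  rewrite /fpair /c /= !fg//.
    rewrite /N ltn_addl// (bigD1 (Ordinal lin))//= addSn ltnS.
    exact: leq_addr.
  exact: ltn_addr.
move=> x; split.
  move=> Ax; have /choice [z zP] k : exists z, F k (fpair x z).
    by apply/(FP k).2; exact: Ax.
  exists (fun n => if unpickle n is Some (k, i) then z k i else 0%N) => k /=.
  rewrite (_ : c _ _ = z k)//; apply/funext => i.
  by rewrite /c /= pickleK.
by move=> [z Fz] k _; apply/(FP k).2; exists (c k z); exact: Fz.
Qed.

Lemma analyticT (V : Type) : analytic [set: nat -> V].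
Proof. by apply: finitary_analytic; exists 0%N. Qed.

Lemma analyticI (V : Type) (A B : set (nat -> V)) :
  analytic A -> analytic B -> analytic (A `&` B).
Proof.
move=> aA aB; rewrite -bigcap2E; apply: analytic_bigcap => -[|[|n]] //=.
exact: analyticT.
Qed.

Lemma analytic_proj (V : Type) (W : countType) (A : set (nat -> V * W)) :
  analytic A -> analytic [set x | exists y, A (fpair x y)].
Proof.
move=> [F cF AF].
(* As [W] is countable, the projected coordinate can be absorbed into the witness. *)
pose e (t : (V * W) * nat) : V * nat := (t.1.1, pickle (t.1.2, t.2)).
exists [set e \o h | h in F].
  apply: tree_closed_map => // -[[v w] n] [[v' w'] n'] [-> wn].
  by have [-> ->] := pcan_inj (@pickleK _) wn.
move=> x; split.
  move=> [y /AF [z Fz]]; exists (fun n => pickle (y n, z n)).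
  by exists (fpair (fpair x y) z).
move=> [z [h Fh hE]]; exists (fun n => (h n).1.2).
apply/AF; exists (fun n => (h n).2).
rewrite (_ : fpair _ _ = h)//; apply/funext => n.
have := congr1 (fun f => (f n).1) hE; rewrite /fpair /e /= => <-.
by case: (h n) => -[].
Qed.

Lemma analytic_comp (V W : Type) (p : W -> V) (A : set (nat -> V)) :
  analytic A -> analytic [set f | A (p \o f)].
Proof.
move=> [F cF AF].
exists [set f | F (fpair (p \o (fst \o f)) (snd \o f))].
  move=> f H; apply: cF => n; have [g Fg fg] := H n.
  by exists (fpair (p \o (fst \o g)) (snd \o g)) => // i /fg; rewrite /fpair /= => ->.
by move=> x /=; rewrite AF.
Qed.

(** Analytic sets need not have analytic complements; keeping track of both gives a sigma-algebra
    that contains the finitary sets, hence the Borel sets. *)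
Definition bianalytic (V : Type) (A : set (nat -> V)) := analytic A /\ analytic (~` A).

Lemma bianalytic_sigma_algebra (V : Type) : sigma_algebra setT (@bianalytic V).
Proof.
split.
- by split; apply: finitary_analytic; exists 0%N.
- by move=> A [aA aCA]; rewrite setTD; split => //; rewrite setCK.
- move=> A aA; split.
    by apply: analytic_bigcup => k; exact: (aA k).1.
  by rewrite setC_bigcup; apply: analytic_bigcap => k; exact: (aA k).2.
Qed.

Lemma sigma_algebra_preimage_system (S T : Type) (f : S -> T) (G : set (set S)) :
  sigma_algebra setT G -> sigma_algebra setT [set A : set T | G (f @^-1` A)].
Proof.
move=> [G0 GC GU]; split=> /=.
- by rewrite preimage_set0.
- by move=> A /GC; rewrite !setTD preimage_setC.
- by move=> A GA; rewrite preimage_bigcup; exact: GU.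
Qed.

Lemma bianalytic_preimage (V : Type) (phi : (nat -> V) -> power2 nat) (A : set (power2 nat)) :
  (forall i, finitary [set f | phi f i]) -> measurable A -> bianalytic (phi @^-1` A).
Proof.
move=> fphi; apply: (power2_sigma_algebra_ind (G := [set A | bianalytic (phi @^-1` A)])).
  exact/sigma_algebra_preimage_system/bianalytic_sigma_algebra.
by move=> i; split; apply: finitary_analytic; [exact: fphi|exact: (finitaryC (fphi i))].
Qed.

Lemma measurable_pair_analytic (A : set (power2 nat * power2 nat)) :
  measurable A -> analytic [set f : nat -> bool * bool | A (fst \o f, snd \o f)].
Proof.
rewrite measurable_prod_measurableType => mA.
pose phi (f : nat -> bool * bool) : power2 nat * power2 nat := (fst \o f, snd \o f).
suff [] : bianalytic (phi @^-1` A) by [].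
apply: (mA [set A | bianalytic (phi @^-1` A)]); split => /=.
  exact/sigma_algebra_preimage_system/bianalytic_sigma_algebra.
move=> _ [B mB [C mC <-]].
have bB : bianalytic ((fun f => fst \o f : power2 nat) @^-1` B : set (nat -> bool * bool)).
  by apply: bianalytic_preimage => // i; exists i.+1 => x y xy /=; rewrite xy.
have bC : bianalytic ((fun f => snd \o f : power2 nat) @^-1` C : set (nat -> bool * bool)).
  by apply: bianalytic_preimage => // i; exists i.+1 => x y xy /=; rewrite xy.
split; first by apply: (analyticI bB.1 bC.1).
rewrite (_ : ~` _ = \bigcup_k bigcup2 (~` ((fun f => fst \o f : power2 nat) @^-1` B))
  (~` ((fun f => snd \o f : power2 nat) @^-1` C)) k).
  apply: analytic_bigcup => -[|[|n]] /=; [exact: bB.2|exact: bC.2|].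
  by apply: finitary_analytic; exists 0%N.
by rewrite bigcup2E -setCI.
Qed.

(** * Lusin separation *)

Lemma branch_exists (T : Type) (x0 : T) (P : seq T -> Prop) :
  P [::] -> (forall s, P s -> exists v, P (rcons s v)) ->
  exists f, forall n, P (mkseq f n).
Proof.
move=> P0 PS; have /choice[step stepP] s : exists v, P s -> P (rcons s v).
  have [/PS[v Pv]|nPs] := pselect (P s); first by exists v.
  by exists x0.
pose u := fix u n := if n is n'.+1 then rcons (u n') (step (u n')) else [::].
exists (step \o u); have uE n : mkseq (step \o u) n = u n.
  by elim: n => // n IH; rewrite mkseqS IH.
by elim=> // n; rewrite !uE => /stepP.
Qed.

Lemma countable_bigcapT_measurable d (T : measurableType d) (I : Type) (F : I -> set T) :
  countable [set: I] -> (forall i, measurable (F i)) -> measurable (\bigcap_i F i).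
Proof.
move=> cI mF; rewrite -[X in measurable X]setCK setC_bigcap; apply: measurableC.
by apply: countable_bigcupT_measurable => // i; exact: measurableC.
Qed.

(** If two pieces cannot be separated, neither can some pair of one-step extensions. Iterating gives
    a point of [F] and a point of [H] none of whose initial segments can be separated; yet their
    first components differ at some bit, as A and B are disjoint, and that bit separates them. *)
Lemma lusin_separation (A B : set (power2 nat)) :
  analytic A -> analytic B -> A `&` B = set0 ->
  exists C : set (power2 nat), [/\ measurable C, A `<=` C & C `&` B = set0].
Proof.
move=> [F cF AF] [H cH BH] AB0.
pose sep s t := exists C : set (power2 nat), [/\ measurable C,
  forall f, F f -> initseg s f -> C (fst \o f) &
  forall f, H f -> initseg t f -> ~ C (fst \o f)].
have [[C [mC FC HC]]|nsep] := pselect (sep [::] [::]).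
  exists C; split=> //.
    by move=> x /AF[z Fz]; exact: (FC _ Fz).
  by rewrite -subset0 => x [Cx /BH[z Hz]]; exact: (HC _ Hz _ Cx).
exfalso.
pose nsep2 (u : seq ((bool * nat) * (bool * nat))) := ~ sep (map fst u) (map snd u).
have [||f fP] := @branch_exists _ ((false, 0%N), (false, 0%N)) nsep2.
- by [].
- move=> s; apply: contra_notP => /forallNP nex.
  have {}nex (v w : bool * nat) : exists C : set (power2 nat), [/\ measurable C,
      forall f, F f -> initseg (rcons (map fst s) v) f -> C (fst \o f) &
      forall f, H f -> initseg (rcons (map snd s) w) f -> ~ C (fst \o f)].
    by have /contrapT := nex (v, w); rewrite !map_rcons.
  have /choice[C CP] vw := nex vw.1 vw.2.
  (* Separating sets for all pairs of extensions combine into one for the original pair. *)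
  exists (\bigcup_v \bigcap_w C (v, w)); split.
  + apply: countable_bigcupT_measurable => [|v]; first exact: countableP.
    by apply: countable_bigcapT_measurable => [|w]; [exact: countableP|have [] := CP (v, w)].
  + move=> g Fg sg; exists (g (size s)) => // w _.
    have [_ + _] := CP (g (size s), w); apply => //=.
    by move: sg; rewrite /initseg /= size_rcons mkseqS size_map => ->.
  + move=> g Hg sg [v _ /(_ (g (size s)) I)].
    have [_ _] := CP (v, g (size s)); apply => //=.
    by move: sg; rewrite /initseg /= size_rcons mkseqS size_map => ->.
have {}fP n : ~ sep (mkseq (fst \o f) n) (mkseq (snd \o f) n).
  by have := fP n; rewrite /nsep2 /mkseq -!map_comp.
(* Otherwise some initial segment has no extension in the closed set [F], and the empty set
   separates. *)
have Ff : F (fst \o f).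
  apply: cF => n; apply: contrapT => nex; apply: (fP n).
  exists set0; split=> [|g Fg|g _ _ []]; first exact: measurable0.
  move=> /initseg_mkseqP ag.
  by apply: nex; exists g => //; exact: agree_sym.
have Hf : H (snd \o f).
  apply: cH => n; apply: contrapT => nex; apply: (fP n).
  exists setT; split=> [||g Hg]//.
  move=> /initseg_mkseqP ag.
  by exfalso; apply: nex; exists g => //; exact: agree_sym.
have [xE|/eqP xN] := eqVneq (fst \o (fst \o f) : power2 nat) (fst \o (snd \o f)).
  have : (A `&` B) (fst \o (fst \o f)).
    split; first by apply/AF; exists (snd \o (fst \o f)); rewrite fpairK.
    by rewrite xE; apply/BH; exists (snd \o (snd \o f)); rewrite fpairK.
  by rewrite AB0.
have [i iN] : exists i, (f i).1.1 <> (f i).2.1.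
  by apply: contrapT => /forallNP H1; apply: xN; apply/funext => i; exact: contrapT (H1 i).
apply: (fP i.+1); exists [set x | x i = (f i).1.1]; split.
- exact: measurable_coord.
- by move=> g _ /initseg_mkseqP/(_ i (ltnSn _)) /= ->.
- by move=> g _ /initseg_mkseqP/(_ i (ltnSn _)) /= -> /esym.
Qed.

(* The n-th bit of g x is decided by a Borel set separating the x whose y has
   n-th bit 1 from those whose y has n-th bit 0. *)
Lemma analytic_sub_graph (A : set (nat -> bool * bool)) :
  analytic A ->
  (forall x y y', A (fpair x y) -> A (fpair x y') -> y = y') ->
  exists2 g : power2 nat -> power2 nat, measurable_fun setT g &
    forall x y, A (fpair x y) -> y = g x.
Proof.
move=> aA A1.
have /choice[C CP] n : exists C : set (power2 nat), [/\ measurable C,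
    [set x | exists y, A (fpair x y) /\ y n = true] `<=` C &
    C `&` [set x | exists y, A (fpair x y) /\ y n = false] = set0].
  have aAb b : analytic [set x | exists y, A (fpair x y) /\ y n = b].
    apply: (@analytic_proj _ _ (A `&` [set f | (f n).2 = b])).
    apply: analyticI => //; apply: finitary_analytic.
    by exists n.+1 => f g fg /=; rewrite fg.
  apply: lusin_separation => //.
  by rewrite -subset0 => x [[y [Ay yn]] [y' [/(A1 _ _ _ Ay) <-]]]; rewrite yn.
exists (fun x n => `[< C n x >]).
  apply: measurable_fun_power2 => // n.
  rewrite setTI (_ : [set _ | _] = C n); first by have [] := CP n.
  by apply/seteqP; split=> x /= /asboolP.
move=> x y Axy; apply/funext => n; have [_ C1 C0] := CP n.
case yn: (y n); apply/esym.
  by apply/asboolP; apply: C1; exists y.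
apply/asboolP => Cx; suff : set0 x by [].
by rewrite -C0; split=> //; exists y.
Qed.

(** * Countable sections *)

Lemma chain_limit (T : Type) (t : nat -> seq T) :
  (forall n, (size (t n) < size (t n.+1))%N /\ take (size (t n)) (t n.+1) = t n) ->
  exists f, forall n, (n <= size (t n))%N /\ initseg (t n) f.
Proof.
move=> tP.
have szt n : (n <= size (t n))%N by elim: n => // n IH; exact: leq_ltn_trans (tP n).1.
have x0 : T by case: (t 1%N) (szt 1%N).
have tle m n : (m <= n)%N -> (size (t m) <= size (t n))%N /\ take (size (t m)) (t n) = t m.
  elim: n => [|n IH]; first by rewrite leqn0 => /eqP->; rewrite take_size.
  rewrite leq_eqVlt => /orP[/eqP->|]; first by rewrite take_size.
  rewrite ltnS => /IH[le tmn]; have [lt tn] := tP n; split.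
    exact: leq_trans le (ltnW lt).
  by rewrite -[RHS]tmn -[in RHS]tn take_takel.
have nth_t m n i : (m <= n)%N -> (i < size (t m))%N -> nth x0 (t m) i = nth x0 (t n) i.
  by move=> mn im; have [_ <-] := tle _ _ mn; rewrite nth_take.
(* Entry m is read from [t m.+1], as [t m] may have length exactly m. *)
exists (fun m => nth x0 (t m.+1) m) => n; split => //.
apply: (@eq_from_nth _ x0); rewrite size_mkseq // => i it.
rewrite nth_mkseq//; have [le|/ltnW le] := leqP i.+1 n; first exact: nth_t.
by rewrite (nth_t n i.+1).
Qed.

Fixpoint words n : seq (seq bool) :=
  if n is n'.+1 then map (cons false) (words n') ++ map (cons true) (words n') else [:: [::]].

(** Nodes of the binary tree are stored with the last bit first, so that a child is obtained by
    [cons]. *)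
Fixpoint revword (sg : nat -> bool) n : seq bool :=
  if n is n'.+1 then sg n' :: revword sg n' else [::].

Lemma mem_revword sg n : revword sg n \in words n.
Proof.
elim: n => // n IH /=; rewrite mem_cat.
by case: (sg n); rewrite map_f ?orbT.
Qed.

Lemma eq_revword sg tau n : (forall m, (m < n)%N -> sg m = tau m) -> revword sg n = revword tau n.
Proof.
elim: n => //= n IH H; rewrite H// IH// => m mn; apply: H; exact: ltnW.
Qed.

Lemma uncountable_cantor (T : Type) (A : set T) (f : (nat -> bool) -> T) :
  (forall sg, A (f sg)) -> injective f -> ~ countable A.
Proof.
move=> Af inj /countable_injP[h hinj].
(* Cantor's diagonal set, read through the numbering [h]; it is then tested at its own number. *)
pose D n := `[< exists sg : nat -> bool, h (f sg) = n /\ ~~ sg n >].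
case DE : (D (h (f D))).
  have /asboolP[sg [hE]] := DE.
  have /inj -> : f sg = f D by apply: hinj => //; rewrite inE; exact: Af.
  by rewrite DE.
by move/asboolPn : (DE); apply; exists D; rewrite DE.
Qed.

Section lusin_novikov.
Local Notation X := (power2 nat).
Local Notation W := ((bool * bool) * nat)%type.
Variables (P : set (X * X)) (F : set (nat -> W)).
Hypothesis cF : tree_closed F.
Hypothesis PF : forall x y, P (x, y) <-> exists z, F (fpair (fpair x y) z).
Hypothesis Pcount : forall x, countable [set y | P (x, y)].

Let px (f : nat -> W) : X := fun n => (f n).1.1.
Let py (f : nat -> W) : X := fun n => (f n).1.2.

(* The family [a] of basic neighbourhoods is not negligible in the sense of the
   header. *)
Let big (a : seq (seq W)) := forall g : nat -> X -> X,
  (forall n, measurable_fun setT (g n)) ->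
  exists x, forall t, t \in a ->
    exists f, [/\ F f, initseg t f, px f = x & forall n, py f <> g n x].

Let big_sub a b : {subset b <= a} -> big a -> big b.
Proof. by move=> ba aP g /aP[x xP]; exists x => t /ba/xP. Qed.

(** Proper extension makes the branches of the later Cantor scheme converge; the uniform place [m]
    keeps their second components distinct. *)
Let splits (t t1 t2 : seq W) := [/\ (size t < size t1)%N /\ take (size t) t1 = t,
  (size t < size t2)%N /\ take (size t) t2 = t &
  exists m, forall f1 f2, initseg t1 f1 -> initseg t2 f2 -> py f1 m <> py f2 m].

(** [big] tests one sequence of graphs at a time, so countably many sequences have to be packed into
    one. *)
Let merge (G : nat -> nat -> X -> X) : (forall k n, measurable_fun setT (G k n)) ->
  exists2 g : nat -> X -> X, forall n, measurable_fun setT (g n) &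
    forall k n, exists m, g m = G k n.
Proof.
move=> mG; exists (fun m => if unpickle m is Some (k, n) then G k n else id).
  by move=> m; case: unpickle => [[k n]|]; [exact: mG|exact: measurable_id].
by move=> k n; exists (pickle (k, n)); rewrite pickleK.
Qed.

Let measurable_neq_graphs (g : nat -> X -> X) : (forall n, measurable_fun setT (g n)) ->
  measurable [set xy : X * X | forall n, xy.2 <> g n xy.1].
Proof.
move=> mg; rewrite (_ : [set _ | _] = \bigcap_n \bigcup_i
    [set xy : X * X | xy.2 i <> g n xy.1 i]); last first.
  apply/seteqP; split=> -[x y] /= H.
    move=> n _; apply: contrapT => H'; apply: (H n); apply/funext => i.
    by apply: contrapT => yi; apply: H'; exists i.
  by move=> n yE; have [i _] := H n I; rewrite /= -yE.
apply: bigcapT_measurable => n; apply: bigcupT_measurable => i.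
have m1 b : measurable [set xy : X * X | g n xy.1 i = b].
  rewrite -[X in measurable X]setTI.
  have : measurable_fun setT (fun xy : X * X => g n xy.1).
    by apply: measurableT_comp => //; exact: measurable_fst.
  by move=> /(_ measurableT _ (measurable_coord i b)).
have m2 b : measurable [set xy : X * X | xy.2 i = b].
  rewrite -[X in measurable X]setTI.
  by have /(_ measurableT _ (measurable_coord i b)) := @measurable_snd _ _ X X.
rewrite (_ : [set _ | _] =
   ([set xy : X * X | xy.2 i = true] `&` [set xy : X * X | g n xy.1 i = false]) `|`
   ([set xy : X * X | xy.2 i = false] `&` [set xy : X * X | g n xy.1 i = true])).
  by apply: measurableU; apply: measurableI.
apply/seteqP; split=> -[x y] /=; case: (y i); case: (g n x i) => //; try by auto.
- by move=> [[]|[]].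
- by move=> [[]|[]].
Qed.

Let analytic_avoid (g : nat -> X -> X) (t : seq W) : (forall n, measurable_fun setT (g n)) ->
  analytic [set h : nat -> bool * bool | (exists z, F (fpair h z) /\ initseg t (fpair h z)) /\
    (forall n, snd \o h <> g n (fst \o h))].
Proof.
move=> mg; apply: analyticI; last first.
  exact: (measurable_pair_analytic (measurable_neq_graphs mg)).
by exists (F `&` initseg t) => //; exact: tree_closed_initseg.
Qed.

Let big_split t a : big (t :: a) -> exists t1 t2, splits t t1 t2 /\ big [:: t1, t2 & a].
Proof.
move=> bta; apply: contrapT => nex.
have /choice[G GP] (u : seq W * seq W) : exists g : nat -> X -> X,
    (forall n, measurable_fun setT (g n)) /\ (splits t u.1 u.2 ->
      forall x, ~ forall t', t' \in [:: u.1, u.2 & a] ->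
      exists f, [/\ F f, initseg t' f, px f = x & forall n, py f <> g n x]).
  have [st|nst] := pselect (splits t u.1 u.2); last first.
    by exists (fun _ => id); split => // n; exact: measurable_id.
  apply: contrapT => ng; apply: nex; exists u.1, u.2; split=> // g mg.
  apply: contrapT => nx; apply: ng; exists g; split=> // _ x H; apply: nx.
  by exists x.
(* There are countably many pairs of candidates, so the graphs refuting each of them merge into one
   sequence [g]. *)
pose G' k := if (unpickle k : option (seq W * seq W)) is Some u then G u else fun _ => id.
have [|g mg gG] := @merge G'.
  move=> k n; rewrite /G'; case: unpickle => [u|]; last exact: measurable_id.
  exact: (GP u).1.
have {}gG u n : exists m, g m = G u n.
  by have [m] := gG (pickle u) n; rewrite /G' pickleK; exists m.
pose A t := [set h : nat -> bool * bool | (exists z, F (fpair h z) /\ initseg t (fpair h z)) /\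
    (forall n, snd \o h <> g n (fst \o h))].
(* The part of [t] off the merged graphs, over those x for which every member of [a] also has such a
   point. *)
pose B := A t `&` [set h | forall t', t' \in a -> exists y, A t' (fpair (fst \o h) y)].
have aB : analytic B.
  apply: analyticI; first exact: analytic_avoid.
  elim: (a) => [|t' a' IH].
    by rewrite (_ : [set _ | _] = setT); [exact: analyticT|rewrite -subTset].
  rewrite (_ : [set _ | _] =
     [set h : nat -> bool * bool | exists y, A t' (fpair (fst \o h) y)] `&`
     [set h | forall t', t' \in a' -> exists y, A t' (fpair (fst \o h) y)]).
    apply: analyticI => //.
    apply: (@analytic_comp _ _ fst [set x | exists y, A t' (fpair x y)]).
    by apply: analytic_proj; exact: analytic_avoid.
  apply/seteqP; split=> h /=.
    move=> H; split=> [|t'' ta]; first by apply: H; rewrite mem_head.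
    by apply: H; rewrite inE ta orbT.
  by move=> [H1 H2] t''; rewrite inE => /orP[/eqP->|/H2].
have [|g0 mg0 Bg0] := analytic_sub_graph aB.
  (* Two values y and y' over the same x would yield initial segments splitting [t], against the
     graphs chosen for that very pair. *)
  move=> x y y' [[[z [Fz tz]] yg] yP] [[[z' [Fz' tz']] y'g] _].
  apply: contrapT => yy'.
  have [m ym] : exists m, y m <> y' m.
    by apply: contrapT => /forallNP H1; apply: yy'; apply/funext => i; exact: contrapT (H1 i).
  pose f := fpair (fpair x y) z; pose f' := fpair (fpair x y') z'.
  (* Long enough to show the difference at [m] and to extend [t] properly. *)
  pose N := (maxn m (size t)).+1.
  have st : (size t < N)%N by rewrite /N ltnS leq_maxr.
  have take_init (h : nat -> W) : initseg t h -> take (size t) (mkseq h N) = t.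
    by rewrite /initseg /= => {2}<-; rewrite /mkseq -map_take take_iota (minn_idPl (ltnW st)).
  have [_ /(_ _ x)] := GP (mkseq f N, mkseq f' N); apply => /=.
    split; rewrite ?size_mkseq; [by split=> //; exact: take_init..|].
    exists m => f1 f2 /initseg_mkseqP f1f /initseg_mkseqP f2f.
    by rewrite /py f1f ?f2f ?ltnS ?leq_maxl.
  move=> t'; rewrite !inE => /or3P[/eqP->|/eqP->|ta].
  - exists f; split=> // [|n]; first exact: initseg_mkseq.
    by have [k <-] := gG (mkseq f N, mkseq f' N) n; exact: yg.
  - exists f'; split=> // [|n]; first exact: initseg_mkseq.
    by have [k <-] := gG (mkseq f N, mkseq f' N) n; exact: y'g.
  - have [y'' [[z'' [Fz'' tz'']] y''g]] := yP _ ta.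
    exists (fpair (fpair x y'') z''); split=> // n.
    by have [k <-] := gG (mkseq f N, mkseq f' N) n; exact: y''g.
(* Together with [g0], the merged graphs catch all points of [t] over the remaining x, which
   contradicts bigness. *)
have [|x xP] := bta (fun n => if n is n'.+1 then g n' else g0).
  by case.
have [f [Ff tf fx fg]] := xP t (mem_head _ _).
apply: (fg 0%N); rewrite -fx; apply: Bg0.
have Af t' h : F h -> initseg t' h -> px h = x -> (forall n, py h <> g n x) ->
    A t' (fpair (px h) (py h)).
  move=> Fh th hx hg; split; last first.
    by move=> n; rewrite -/(px h) -/(py h) /comp /= hx; exact: hg.
  exists (snd \o h); rewrite (_ : fpair _ _ = h)//.
  by apply/funext => n; rewrite /fpair /px /py /=; case: (h n) => -[].
split; first by apply: Af => // n; exact: (fg n.+1).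
move=> t' ta; have [|f' [Ff' tf' fx' fg']] := xP t'; first by rewrite inE ta orbT.
exists (py f'); have -> : fst \o fpair (px f) (py f) = px f by [].
by rewrite fx -fx'; apply: Af => // n; exact: (fg' n.+1).
Qed.

(** The members are split one at a time; [r] holds the halves already obtained, so the induction has
    to be uniform in it. *)
Let big_double (I : eqType) (c : I -> seq W) (s : seq I) r : big (map c s ++ r) ->
  exists c1 c2 : I -> seq W, (forall i, i \in s -> splits (c i) (c1 i) (c2 i)) /\
    big (map c1 s ++ map c2 s ++ r).
Proof.
elim: s r => [|i s IH] r.
  by exists c, c.
move=> /big_split[t1 [t2 [st b12]]].
have [|c1 [c2 [cP bc]]] := IH [:: t1, t2 & r].
  apply: big_sub b12 => t; rewrite !(inE, mem_cat).
  by do !case: (_ \in _) => //=; do !case: (_ == _).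
(* If [i] recurs in [s], its other halves are dropped, which bigness survives. *)
exists (fun j => if j == i then t1 else c1 j), (fun j => if j == i then t2 else c2 j); split.
  move=> j; rewrite inE; case: eqP => [->//|_ /= js]; exact: cP.
apply: big_sub bc => t; rewrite /= eqxx !(inE, mem_cat) => /orP[/eqP->|].
  by rewrite eqxx !orbT.
move=> /orP[/mapP[j js ->]|].
  by case: eqP => _; [rewrite eqxx !orbT|rewrite map_f].
move=> /orP[/eqP->|]; first by rewrite eqxx !orbT.
move=> /orP[/mapP[j js ->]|->]; last by rewrite !orbT.
by case: eqP => _; [rewrite eqxx !orbT|rewrite (map_f c2)// orbT].
Qed.


(** Splitting builds a Cantor scheme [c n w] whose levels are all big. All nodes of a level have
    points over a common x, so in the limit all branches share the first component, while splitting
    keeps the second ones distinct: a section of [P] would be uncountable. *)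
Let not_big : ~ big [:: [::]].
Proof.
move=> b0.
have /choice[nxt nxtP] (nc : nat * (seq bool -> seq W)) : exists c' : seq bool -> seq W,
    big (map nc.2 (words nc.1)) ->
    (forall w, w \in words nc.1 -> splits (nc.2 w) (c' (false :: w)) (c' (true :: w))) /\
    big (map c' (words nc.1.+1)).
  have [bc|nbc] := pselect (big (map nc.2 (words nc.1))); last by exists nc.2.
  have [|c1 [c2 [cP bc']]] := @big_double _ nc.2 (words nc.1) [::].
    by rewrite cats0.
  exists (fun w => if w is b :: w' then (if b then c2 w' else c1 w') else [::]) => _.
  by split=> //=; rewrite map_cat -!map_comp -[X in _ ++ X]cats0.
pose c := fix c n := if n is n'.+1 then nxt (n', c n') else fun _ => [::].
have bc n : big (map (c n) (words n)).
  by elim: n => // n IH; exact: (nxtP (n, c n) IH).2.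
have splitc n w : w \in words n -> splits (c n w) (c n.+1 (false :: w)) (c n.+1 (true :: w)).
  exact: (nxtP (n, c n) (bc n)).1.
have /choice[f fP] sg : exists f, forall n, (n <= size (c n (revword sg n)))%N /\
    initseg (c n (revword sg n)) f.
  apply: chain_limit => n; have [Hf Ht _] := splitc n _ (mem_revword sg n).
  by rewrite [revword sg n.+1]/=; case: (sg n).
(* Only the common x is wanted from bigness here, so it is tested on identity functions. *)
have bigf sg tau n : exists h h', [/\ F h, initseg (c n (revword sg n)) h,
    initseg (c n (revword tau n)) h' & px h = px h'].
  have [|x xP] := bc n (fun _ => id); first by move=> _; exact: measurable_id.
  have [|h [Fh hs hx _]] := xP (c n (revword sg n)); first by rewrite map_f ?mem_revword.
  have [|h' [_ hs' hx' _]] := xP (c n (revword tau n)); first by rewrite map_f ?mem_revword.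
  by exists h, h'; rewrite hx.
have agr n sg h : initseg (c n (revword sg n)) h -> agree n (f sg) h.
  have [le] := fP sg n; rewrite /initseg /mkset => {2}<- /esym/eq_mkseqP.
  exact: agree_le.
have Ff sg : F (f sg).
  apply: cF => n; have [h [_ [Fh hs _ _]]] := bigf sg sg n.
  by exists h => //; exact: agr.
have pxf sg tau : px (f sg) = px (f tau).
  apply/funext => m; have [h [h' [_ /agr hs /agr hs' hh']]] := bigf sg tau m.+1.
  have := congr1 (fun x : X => x m) hh'.
  by rewrite /px hs// hs'.
have injf sg tau : py (f sg) = py (f tau) -> sg = tau.
  move=> pE; apply: contrapT => st.
  have [n stn] : exists n, sg n != tau n.
    apply: contrapT => H; apply: st; apply/funext => n.
    by apply/eqP/negP => /negP stn; apply: H; exists n.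
  (* At the first difference the two branches leave the same node, through its two halves. *)
  have [{}n {}stn nmin] := ex_minnP (ex_intro (fun n => sg n != tau n) n stn).
  have rw : revword sg n = revword tau n.
    apply: eq_revword => m mn; apply/eqP; apply: contraTT mn => /nmin.
    by rewrite -leqNgt.
  have [_ _ [m mP]] := splitc n _ (mem_revword sg n).
  have := (fP sg n.+1).2; have := (fP tau n.+1).2.
  move: stn; rewrite [revword sg _]/= [revword tau _]/= -rw.
  case: (sg n); case: (tau n) => // _ h1 h2.
    by apply: (mP _ _ h1 h2); rewrite pE.
  by apply: (mP _ _ h2 h1); rewrite pE.
pose sg0 : nat -> bool := fun _ => false.
apply: (@uncountable_cantor _ _ (fun sg => py (f sg)) _ injf (Pcount (px (f sg0)))) => sg /=.
apply/PF; exists (snd \o f sg); rewrite (pxf _ sg) (_ : fpair _ _ = f sg)//.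
by apply/funext => n; rewrite /fpair /px /py /=; case: (f sg n) => -[].
Qed.

Lemma sub_graphs_of_tree_closed : exists g : nat -> X -> X,
  (forall n, measurable_fun setT (g n)) /\ forall x y, P (x, y) -> exists n, y = g n x.
Proof.
apply: contrapT => nex; apply: not_big => g mg.
apply: contrapT => nx; apply: nex; exists g; split => // x y /PF[z Fz].
apply: contrapT => /forallNP ny; apply: nx; exists x => t; rewrite inE => /eqP->.
by exists (fpair (fpair x y) z).
Qed.

End lusin_novikov.

Lemma lusin_novikov (P : set (power2 nat * power2 nat)) : measurable P ->
  (forall x, countable [set y | P (x, y)]) -> exists g : nat -> power2 nat -> power2 nat,
  (forall n, measurable_fun setT (g n)) /\ forall x y, P (x, y) -> exists n, y = g n x.
Proof.
move=> /measurable_pair_analytic[F cF PF] Pc.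
apply: (sub_graphs_of_tree_closed cF _ Pc) => x y.
by have := PF (fpair x y).
Qed.

(** * Coding Polish spaces in the Cantor space *)

Lemma metric_ball_open (R : realType) (P : metricType R) (x : P) (e : R) : open (ball x e).
Proof.
rewrite openE => y; rewrite ballEmdist /= => xy; apply/nbhs_ballP.
exists (e - mdist x y)%R; first by rewrite /= subr_gt0.
move=> z; rewrite !ballEmdist /= ltrBrDl; apply: le_lt_trans.
exact: metric_triangle.
Qed.

Section cantor_coding.
Variables (R : realType) (P : metricType R).
Local Open Scope ring_scope.
Let r (j : nat) : R := j.+1%:R^-1.

Let r_gt0 j : 0 < r j. Proof. by rewrite invr_gt0. Qed.

(** In [base] three radii add up: from p to the centre, across the ball, and to a point of the
    closure. *)
Let r_small (e : R) : 0 < e -> exists j, 3 * r j < e.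
Proof.
move=> e0; have [j _ Hj] := near_infty_natSinv_lt (PosNum (divr_gt0 e0 (ltr0n _ 3))).
exists j; have := Hj j (leqnn j) => /=.
by rewrite ltr_pdivlMr// mulrC.
Qed.

Variables (S : set P) (f : P -> nat).
Hypothesis dS : dense S.
Hypothesis f_inj : {in S &, injective f}.
Hypothesis completeP : forall F : set_system P, ProperFilter F -> cauchy F ->
  exists l : P, F --> l.

(** A countable base: balls around the points of [S], the centre being given by its number under
    [f]; indices coding no ball give the empty set. *)
Let U n : set P := if (unpickle n : option (nat * nat)) is Some (i, j)
  then [set p | exists c, [/\ S c, f c = i & ball c (r j) p]] else set0.

Let UE c j : S c -> U (pickle (f c, j)) = ball c (r j).
Proof.
move=> Sc; rewrite /U pickleK; apply/seteqP; split=> p /=; last by exists c.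
by move=> [c' [Sc' /f_inj <-]]//; rewrite inE.
Qed.

Let open_U n : open (U n).
Proof.
rewrite /U; case: unpickle => [[i j]|]; last exact: open0.
have [[c [Sc ci]]|nc] := pselect (exists c, S c /\ f c = i).
  rewrite (_ : [set _ | _] = ball c (r j)).
    exact: metric_ball_open.
  apply/seteqP; split=> p /=; last by exists c.
  by move=> [c' [Sc']]; rewrite -ci => /f_inj <-//; rewrite inE.
rewrite (_ : [set _ | _] = set0); first exact: open0.
by rewrite -subset0 => p [c [Sc ci _]]; apply: nc; exists c.
Qed.

Let approx p j : exists c, [/\ S c, ball c (r j) p & ball p (r j) c].
Proof.
have [|c [pc Sc]] := dS (_ : (ball p (r j))^° !=set0) (open_interior _).
  by exists p; apply: nbhsx_ballx.
have {}pc := interior_subset pc.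
by exists c; split=> //; exact: ball_sym.
Qed.

Let base (O : set P) p : open O -> O p -> exists n, U n p /\ closure (U n) `<=` O.
Proof.
move=> oO Op; have [e /= e0 eO] := (nbhs_ballP p O).1 (open_nbhs_nbhs (conj oO Op)).
have [j je] := r_small e0; have [c [Sc cp pc]] := approx p j.
exists (pickle (f c, j)); rewrite UE//; split=> // x /(_ _ (nbhsx_ballx x _ (r_gt0 j))).
move=> [z [cz xz]]; apply: eO; apply: (@le_ball _ _ _ (r j + r j + r j)).
  by rewrite -mulr2n -mulrSr -mulr_natl ltW.
by apply: ball_triangle (ball_sym xz); exact: ball_triangle cz.
Qed.

Let q (p : P) : power2 nat := fun n => `[< U n p >].

Let inj_q : injective q.
Proof.
move=> p p' pE; apply: metric_hausdorff => A B Ap Bp'.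
have [n [Unp UA]] : exists n, U n p /\ U n `<=` A.
  have [n [Un UA]] := @base A^° p (open_interior _) Ap.
  exists n; split=> // z Uz; apply: interior_subset; apply: UA; exact: subset_closure.
exists p'; split; last exact: nbhs_singleton.
apply: UA; have /(congr1 (fun x : power2 nat => x n)) := pE.
by rewrite /q /= => /esym E; apply/asboolP; rewrite E; apply/asboolP.
Qed.

(* [code y] makes the sets U n with y n = 1 a base of the neighbourhood filter of
   a point; it is a countable combination of clopen conditions on y. *)
Let code (y : power2 nat) := [/\ forall j : nat, exists i : nat, y (pickle (i, j)),
  forall n m : nat, y n -> y m -> exists l : nat, y l /\ closure (U l) `<=` U n `&` U m,
  forall n m : nat, U n `<=` U m -> y n -> y m & forall n : nat, y n -> U n !=set0].

Let code_q p : code (q p).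
Proof.
split.
- move=> j; have [c [Sc cp _]] := approx p j.
  by exists (f c); apply/asboolP; rewrite UE.
- move=> n m /asboolP Un /asboolP Um.
  have [|//|l [Ul lnm]] := @base (U n `&` U m) p; first exact: openI.
  by exists l; split=> //; exact/asboolP.
- by move=> n m nm /asboolP/nm Um; exact/asboolP.
- by move=> n /asboolP Un; exists p.
Qed.

(** The sets listed by [y] generate a filter, which is Cauchy since it contains balls of every
    radius [r j]; [y] is the code of its limit. *)
Let q_code y : code y -> exists p, y = q p.
Proof.
move=> [C1 C2 C3 C4].
pose F := filter_from [set n | y n] U.
have FF : ProperFilter F.
  apply: filter_from_proper; last by move=> n; exact: C4.
  apply: filter_from_filter; first by have [i yi] := C1 0%N; exists (pickle (i, 0%N)).
  move=> n m yn ym; have [l [yl lnm]] := C2 _ _ yn ym.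
  by exists l => //; apply: subset_trans lnm; exact: subset_closure.
have small j : exists c, [/\ S c, y (pickle (f c, j)) & F (ball c (r j))].
  have [i yi] := C1 j; have [p] := C4 _ yi.
  rewrite {1}/U pickleK => -[c [Sc ci _]]; rewrite -ci in yi.
  by exists c; split=> //; exists (pickle (f c, j)) => //; rewrite UE.
have [|l Fl] := completeP FF.
  apply: cauchy_exP => e e0; have [j je] := r_small e0.
  have [c [_ _ Fc]] := small j; exists c; apply: filterS Fc; apply: le_ball.
  apply: ltW; apply: le_lt_trans je; rewrite ler_peMl//; first exact: ltW.
  by rewrite ler1n.
(* The limit is only known to lie in the closures of the sets of the filter, whence the closure in
   the second clause of [code]. *)
have yU n : y n -> U n l.
  move=> yn; have [m [ym mn]] := C2 _ _ yn yn.
  have [] // := mn l _ => A /Fl FA.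
  by apply: (@filter_ex _ F); apply: filterI => //; exists m.
(* Conversely, a listed ball of small radius contains l and so lies inside [U n]; the third clause
   then lists n. *)
exists l; apply/funext => n; apply/idP/asboolP => [/yU//|Un].
have [e /= e0 eU] := (nbhs_ballP l _).1 (open_nbhs_nbhs (conj (open_U n) Un)).
have [j je] := r_small e0; have [c [Sc yc _]] := small j.
have := yU _ yc; move: yc => /[swap] Ul /C3; apply; move: Ul.
rewrite UE// => cl x cx.
apply: eU; apply: (@le_ball _ _ _ (r j + r j)).
  by have := r_gt0 j; lra.
by apply: ball_triangle cx; exact: ball_sym.
Qed.

Let measurable_code : measurable [set y | code y].
Proof.
have m n : measurable [set y : power2 nat | y n] by exact: (measurable_coord n true).
rewrite (_ : [set _ | _] = [set y : power2 nat |
  (forall j : nat, exists i : nat, y (pickle (i, j))) /\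
  (forall n m : nat, y n -> y m -> exists l : nat, y l /\ closure (U l) `<=` U n `&` U m) /\
  (forall n m : nat, U n `<=` U m -> y n -> y m) /\
  (forall n : nat, y n -> U n !=set0)]); last first.
  by apply/seteqP; split=> y; [move=> [? ? ? ?]|move=> [? [? [? ?]]]].
apply: measurable_set_and; [|apply: measurable_set_and; [|apply: measurable_set_and]].
- by apply: measurable_set_forall => j; apply: measurable_set_exists => i.
- apply: measurable_set_forall => n; apply: measurable_set_forall => k.
  do 2!apply: measurable_set_imply => //.
  by apply: measurable_set_exists => l; apply: measurable_set_and => //; exact: measurable_set_prop.
- apply: measurable_set_forall => n; apply: measurable_set_forall => k.
  apply: measurable_set_imply; first exact: measurable_set_prop.
  exact: measurable_set_imply.
- by apply: measurable_set_forall => n; apply: measurable_set_imply => //; exact: measurable_set_prop.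
Qed.

(** The range is the Borel set of codes, and an open set is mapped to the trace on it of a union of
    coordinate sets. As [q] is injective, images commute with complements relative to the range, so
    open sets suffice. *)
Lemma cantor_coding : exists q : P -> power2 nat, [/\ injective q,
  forall n, open [set p | q p n] & forall B, <<s @open P >> B -> measurable (q @` B)].
Proof.
exists q; split => //.
  by move=> n; rewrite (_ : [set _ | _] = U n)//; apply/seteqP; split=> p /asboolP.
have mq : measurable (range q).
  rewrite (_ : range q = [set y | code y])//; apply/seteqP; split=> y.
    by move=> [p _ <-]; exact: code_q.
  by move=> /q_code[p ->]; exists p.
move=> B mB; apply: (mB [set B | measurable (q @` B)]); split.
  split=> [|A mA|A mA] /=.
  - by rewrite image_set0.
  - rewrite setTD (_ : q @` _ = range q `\` q @` A); first exact: measurableD.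
    apply/seteqP; split=> y.
      by move=> [p nAp <-]; split; [exists p|move=> [p' Ap' /inj_q pE]; apply: nAp; rewrite -pE].
    by move=> [[p _ <-] nA]; exists p => // Ap; apply: nA; exists p.
  - by rewrite image_bigcup; exact: bigcupT_measurable.
move=> O oO /=.
rewrite (_ : q @` O = range q `&` [set y | exists n : nat, U n `<=` O /\ y n]).
  apply: measurableI => //; apply: measurable_set_exists => n; apply: measurable_set_and.
    exact: measurable_set_prop.
  exact: (measurable_coord n true).
apply/seteqP; split=> y.
  move=> [p Op <-]; split; first by exists p.
  have [n [Un UO]] := base oO Op; exists n; split; last exact/asboolP.
  by apply: subset_trans UO; exact: subset_closure.
by move=> [[p _ <-] [n [UO /asboolP/UO Op]]]; exists p.
Qed.

End cantor_coding.

(** * Closed subsets of 2^I are standard Borel *)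

Definition cantor_agree (I : countType) (n : nat) (x y : I -> bool) :=
  forall i, (pickle i < n)%N -> x i = y i.

Section first_difference_metric.
Local Open Scope ring_scope.
Variables (R : realType) (I : countType).
Local Notation r n := (n.+1%:R^-1 : R).

Lemma ler_invn m n : (r m <= r n) = (n <= m)%N.
Proof. by rewrite lef_pV2 ?posrE// ler_nat. Qed.

(** The value is 1/(m+1), where m+1 is the least level of disagreement; level 0 never is one,
    agreement there being vacuous. *)
Lemma first_difference (x y : I -> bool) : exists d : R,
  (d = 0 \/ exists n, d = r n) /\ forall n, d <= r n <-> cantor_agree n x y.
Proof.
have [xy|/existsNP nxy] := pselect (forall n, cantor_agree n x y).
  exists 0; split; first by left.
  by move=> n; split=> // _; rewrite invr_ge0.
have {}nxy : exists n, `[< ~ cantor_agree n x y >] by have [n ?] := nxy; exists n; apply/asboolP.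
have [[|m] /asboolP xym minm] := ex_minnP nxy; first by exfalso; apply: xym.
exists (r m); split; first by right; exists m.
move=> n; rewrite ler_invn; split=> [nm|xyn].
  by apply: contrapT => nxyn; have := minm n (asboolT nxyn); rewrite leqNgt ltnS nm.
rewrite leqNgt; apply/negP => mn; apply: xym => i im; apply: xyn.
exact: leq_trans mn.
Qed.

Definition diff_dist x y : R := sval (cid (first_difference x y)).

Lemma diff_dist_val x y : diff_dist x y = 0 \/ exists n, diff_dist x y = r n.
Proof. exact: (svalP (cid (first_difference x y))).1. Qed.

Lemma diff_distP x y n : diff_dist x y <= r n <-> cantor_agree n x y.
Proof. exact: (svalP (cid (first_difference x y))).2. Qed.

Lemma diff_dist_eq0 x y : (forall n, cantor_agree n x y) -> diff_dist x y = 0.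
Proof.
move=> xy; have [//|[n dn]] := diff_dist_val x y.
have /diff_distP := xy n.+1; rewrite dn ler_invn.
by rewrite ltnn.
Qed.

Lemma diff_distxx x : diff_dist x x = 0.
Proof. exact: diff_dist_eq0. Qed.

Lemma diff_dist0 x y : diff_dist x y = 0 -> x = y.
Proof.
move=> xy; apply/funext => i.
have /diff_distP : diff_dist x y <= r (pickle i).+1 by rewrite xy invr_ge0.
by apply.
Qed.

Lemma diff_dist_sym x y : diff_dist x y = diff_dist y x.
Proof.
have le a b : diff_dist a b <= diff_dist b a.
  have [ba|[n ba]] := diff_dist_val b a.
    by have -> := diff_dist0 ba; rewrite diff_distxx.
  rewrite ba; apply/diff_distP => i ni; apply/esym; move: i ni.
  by apply/diff_distP; rewrite ba.
by apply/eqP; rewrite eq_le !le.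
Qed.

Lemma diff_dist_ge0 x y : 0 <= diff_dist x y.
Proof. by have [->|[n ->]] := diff_dist_val x y; rewrite ?invr_ge0. Qed.

Lemma diff_dist_triangle y x z : diff_dist x z <= diff_dist x y + diff_dist y z.
Proof.
(* The stronger ultrametric inequality holds because agreement up to n is transitive. *)
suff : diff_dist x z <= Num.max (diff_dist x y) (diff_dist y z).
  move=> /le_trans; apply; rewrite ge_max lerDl lerDr !diff_dist_ge0//.
set M := Num.max _ _.
have [xyM yzM] : diff_dist x y <= M /\ diff_dist y z <= M.
  by rewrite !le_max !lexx orbT.
have : M = 0 \/ exists n, M = r n.
  by rewrite /M; case: leP => _; exact: diff_dist_val.
move=> [M0|[n Mn]].
  have -> : x = y by apply/diff_dist0/le_anti; rewrite -{1}M0 xyM diff_dist_ge0.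
  exact: yzM.
rewrite Mn; apply/diff_distP => i ni.
have /diff_distP -> // : diff_dist x y <= r n by rewrite -Mn.
by have /diff_distP -> // : diff_dist y z <= r n by rewrite -Mn.
Qed.

End first_difference_metric.

(** [R] is a parameter of the type since the metric put on it takes values in [R]. *)
Definition cantor_sub (R : realType) (I : countType) (D : set (I -> bool)) : Type :=
  {x : I -> bool | D x}.

Section cantor_sub_metric.
Variables (R : realType) (I : countType) (D : set (I -> bool)).
Local Notation P := (cantor_sub R D).

HB.instance Definition _ := gen_eqMixin P.
HB.instance Definition _ := gen_choiceMixin P.

Let dist (x y : P) : R := diff_dist R (sval x) (sval y).

Let dist_xx x : dist x x = 0%R. Proof. exact: diff_distxx. Qed.

Let dist0 x y : dist x y = 0%R -> x = y.
Proof. by move=> /diff_dist0; exact: eq_sig_hprop. Qed.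

Let dist_sym x y : dist x y = dist y x. Proof. exact: diff_dist_sym. Qed.

Let dist_triangle y x z : (dist x z <= dist x y + dist y z)%R.
Proof. exact: diff_dist_triangle. Qed.

HB.instance Definition _ := isMetric.Build R P dist_xx dist0 dist_sym dist_triangle.

End cantor_sub_metric.

Section closed_sub_cantor.
Variables (R : realType) (I : countType) (D : set (power2 I)).
Hypothesis closedD : forall x, (forall n, exists2 y, D y & cantor_agree n y x) -> D x.
Let P : metricType R := cantor_sub R D.

Let ballP (x : P) n : (ball x (n.+1%:R^-1 : R)%R : set P) `<=`
  [set y | cantor_agree n (sval x) (sval y)].
Proof. by move=> y; rewrite ballEmdist /= => /ltW /diff_distP. Qed.

Let nbhs_agreeP (x : P) (A : set P) :
  nbhs x A <-> exists n, forall y : P, cantor_agree n (sval x) (sval y) -> A y.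
Proof.
split.
  move=> /nbhs_ballP[e /= e0 eA].
  have [n _ Hn] := near_infty_natSinv_lt (PosNum e0).
  exists n => y xy; apply: eA; rewrite ballEmdist /=.
  by apply: le_lt_trans (Hn n (leqnn n)); apply/diff_distP.
move=> [n nA]; apply/nbhs_ballP; exists (n.+1%:R^-1)%R => /=.
  by rewrite invr_gt0.
by move=> y /ballP; exact: nA.
Qed.

(** A base of clopen sets indexed by a countable type. *)
Let pattern (ns : nat * seq bool) (x : I -> bool) :=
  forall i, (pickle i < ns.1)%N -> x i = nth false ns.2 (pickle i).

Let pattern_exists n (x : I -> bool) : exists s, pattern (n, s) x.
Proof.
exists (mkseq (fun k => if unpickle k is Some i then x i else false) n) => i /= ni.
by rewrite nth_mkseq// pickleK.
Qed.

Let pattern_agree n s x y : pattern (n, s) x -> pattern (n, s) y -> cantor_agree n x y.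
Proof. by move=> xs ys i ni; rewrite xs// ys. Qed.

Let measurable_pattern ns : measurable [set x : power2 I | pattern ns x].
Proof.
apply: measurable_set_forall => i; apply: measurable_set_imply; first exact: measurable_set_prop.
exact: measurable_coord.
Qed.

Let measurableD : measurable D.
Proof.
rewrite (_ : D = [set x | forall n : nat, exists s : seq bool,
    (exists2 y, D y & pattern (n, s) y) /\ pattern (n, s) x]).
  apply: measurable_set_forall => n; apply: measurable_set_exists => s.
  by apply: measurable_set_and; [exact: measurable_set_prop|exact: measurable_pattern].
apply/seteqP; split=> x.
  by move=> Dx n; have [s sx] := pattern_exists n x; exists s; split=> //; exists x.
move=> H; apply: closedD => n; have [s [[y Dy sy] sx]] := H n.
by exists y => //; exact: pattern_agree sy sx.
Qed.

Let separableP : exists2 S : set P, countable S & dense S.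
Proof.
(* One point is chosen from each pattern that meets [D]. *)
have /choice[pt ptP] (ns : nat * seq bool) : exists o : option P,
    (exists x : P, pattern ns (sval x)) -> exists2 x : P, o = Some x & pattern ns (sval x).
  have [[x nsx]|nx] := pselect (exists x : P, pattern ns (sval x)); last by exists None.
  by exists (Some x) => _; exists x.
exists [set x | exists ns, pt ns = Some x].
  have /choice[h hP] (x : P) : exists k : nat, (exists ns, pt ns = Some x) ->
      exists2 ns, pt ns = Some x & pickle ns = k.
    have [[ns nsx]|nx] := pselect (exists ns, pt ns = Some x); last by exists 0%N.
    by exists (pickle ns) => _; exists ns.
  apply/countable_injP; exists h => x y.
  rewrite !inE => /= /hP[ns ox <-] /hP[ms oy <-] /(pcan_inj (@pickleK _)) E.
  by move: ox; rewrite E oy => -[].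
move=> O [x Ox] oO.
have /nbhs_agreeP[n nO] := open_nbhs_nbhs (conj oO Ox).
have [s sx] := pattern_exists n (sval x).
have [|y oy sy] := ptP (n, s); first by exists x.
by exists y; split; [apply: nO; exact: pattern_agree sx sy|exists (n, s)].
Qed.

Let completeP (F : set_system P) : ProperFilter F -> cauchy F -> exists l : P, F --> l.
Proof.
move=> FF /cauchyP cF.
have /choice[x xP] n : exists x : P, F [set y | cantor_agree n (sval x) (sval y)].
  have [|x Fx] := cF (n.+1%:R^-1)%R; first by rewrite invr_gt0.
  by exists x; apply: filterS Fx; exact: ballP.
(* Coordinate i is read from an approximant that the filter follows up to level [(pickle i).+1],
   hence at i itself. *)
pose l i := sval (x (pickle i).+1) i.
have Fl (n : nat) : F [set y : P | cantor_agree n (sval y) l].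
  elim: n => [|n IH]; first by apply: filterE => y i.
  apply: filterS (filterI IH (xP n.+1)) => y [yl yx] i.
  rewrite ltnS leq_eqVlt => /orP[/eqP iE|]; last exact: yl.
  by rewrite /l iE yx ?iE.
have Dl : D l.
  apply: closedD => n; have [y yl] := filter_ex (Fl n).
  by exists (sval y) => //; exact: svalP.
exists (exist _ l Dl : P) => A /nbhs_agreeP[n nA].
by apply: filterS (Fl n) => y yl; apply: nA => i ni /=; rewrite yl.
Qed.

Lemma standard_borel_closed_cantor : standard_borel R D.
Proof.
split; first exact: measurableD.
exists P, (fun x => sval x : power2 I); split.
- by split; [exact: separableP|exact: completeP].
- split=> [x _|x y _ _|x Dx]; first exact: svalP.
    exact: eq_sig_hprop.
  by exists (exist _ x Dx).
apply/seteqP; split.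
  apply: smallest_sub; first exact/sigma_algebra_preimage/smallest_sigma_algebra.
  move=> O oO.
  exists [set y : power2 I | exists ns,
      (forall x : P, pattern ns (sval x) -> O x) /\ pattern ns y].
    apply: measurable_set_exists => ns; apply: measurable_set_and; first exact: measurable_set_prop.
    exact: measurable_pattern.
  rewrite setTI; apply/seteqP; split=> x /=; first by move=> [ns [nsO /nsO]].
  move=> Ox; have /nbhs_agreeP[n nO] := open_nbhs_nbhs (conj oO Ox).
  have [s sx] := pattern_exists n (sval x); exists (n, s); split=> // y sy.
  by apply: nO; exact: pattern_agree sx sy.
move=> _ [M mM <-]; rewrite setTI.
apply: (power2_sigma_algebra_ind (G := [set M : set (power2 I) |
  <<s @open P >> ((fun x : P => sval x : power2 I) @^-1` M)])) mM.
  exact/sigma_algebra_preimage_system/smallest_sigma_algebra.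
move=> i; apply: sub_sigma_algebra; rewrite openE => x /= xi.
by apply/nbhs_agreeP; exists (pickle i).+1 => y /= <-.
Qed.

End closed_sub_cantor.

(** [Tr X] is closed: given closure under prefixes, being nonempty means containing the root, and
    each other condition concerns two coordinates. *)
Lemma standard_borel_Tr (R : realType) (X : countType) : standard_borel R (Tr X).
Proof.
apply: standard_borel_closed_cantor => T H; split.
  have [T' [[u T'u] T'p] T'T] := H (pickle ([::] : seq X)).+1.
  by exists [::]; rewrite -T'T//; apply: T'p T'u; exact: prefix0s.
move=> u v uv Tv; have [T' [_ T'p] T'T] := H (maxn (pickle u) (pickle v)).+1.
rewrite -T'T ?ltnS ?leq_maxl//; apply: T'p uv _.
by rewrite T'T ?ltnS ?leq_maxr.
Qed.

(** * Reductions *)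

Lemma p2_leP (A B : power2 M2) : p2_le A B <-> exists m, forall w, A w = B (m ++ w).
Proof.
split=> -[m mAB]; exists m.
  move=> w; have E := congr1 (fun S : set M2 => S (m ++ w)) mAB.
  apply/idP/idP => [Aw|Bw].
    have : [set m ++ w | w in [set w | A w]] (m ++ w) by exists w.
    by rewrite E => -[].
  have : ([set w | B w] `&` range (cat m)) (m ++ w) by split=> //; exists w.
  rewrite -E => -[w' /= Aw' /eqP]; rewrite eqseq_cat// => /andP[_ /eqP <-//].
apply/seteqP; split=> v.
  by move=> [w /= Aw <-]; split; [rewrite /= -mAB|exists w].
by move=> [/= Bv [w _ vE]]; exists w => //=; rewrite mAB vE.
Qed.

(** The default case keeps the root and the midpoint 0 of a letter code in the tree whatever [A]
    is. *)
Fixpoint tree_code (A : power2 M2) (u : seq bool) : bool :=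
  match u with
  | true :: u' => A [::] && nilp u'
  | false :: b :: u' => tree_code (fun w => A (b :: w)) u'
  | _ => true
  end.

Fixpoint letters (m : seq bool) : seq bool :=
  if m is b :: m' then false :: b :: letters m' else [::].

Lemma tree_code_letters A m u :
  tree_code A (letters m ++ u) = tree_code (fun w => A (m ++ w)) u.
Proof. by elim: m A => //= b m IH A; rewrite IH. Qed.

Lemma lettersP u : (exists m, u = letters m) \/ (exists m, u = letters m ++ [:: false]) \/
  (exists m u', u = letters m ++ true :: u').
Proof.
have [n] := ubnP (size u); elim: n u => // n IH [|[] [|b u]] /=.
- by left; exists [::].
- by right; right; exists [::], [::].
- by right; right; exists [::], (b :: u).
- by right; left; exists [::].
rewrite ltnS => /ltnW/IH[[m ->]|[[m ->]|[m [u' ->]]]].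
- by left; exists (b :: m).
- by right; left; exists (b :: m).
- by right; right; exists (b :: m), u'.
Qed.

Lemma letters_inj : injective letters.
Proof. by elim=> [|b m IH] [|b' m']//= [-> /IH ->]. Qed.

Lemma tree_code_prefix A u v : prefix u v -> tree_code A v -> tree_code A u.
Proof.
have [n] := ubnP (size u); elim: n A u v => // n IH A [|[] [|b u]] [|b' v]//=.
- by move=> _ /andP[/eqP<- _] /andP[->].
- by move=> _ /andP[/eqP<- uv] /andP[_ /nilP vE]; rewrite vE in uv.
rewrite ltnS => /ltnW un /andP[/eqP<-]; case: v => // b'' v /andP[/eqP<-].
exact: IH.
Qed.

Lemma tree_code_Lambda A : Lambda bool (tree_code A).
Proof.
split; first by split; [exists [::]|exact: tree_code_prefix].
(* Codes of words are in the tree whatever [A] is; the powers of one generator give infinitely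
   many. *)
pose l n := letters (nseq n false).
have l_inj : injective l.
  by move=> m n /letters_inj/(congr1 size); rewrite !size_nseq.
move=> /(finite_preimage (f := l) (in2W l_inj)).
rewrite (_ : _ @^-1` _ = setT); first exact: infinite_nat.
rewrite -subTset => n _ /=.
by rewrite -[l n]cats0 tree_code_letters.
Qed.

Lemma measurable_tree_code : measurable_fun setT (tree_code : power2 M2 -> power2 (seq bool)).
Proof.
apply: measurable_fun_power2 => // u; rewrite setTI.
have [[m ->]|[[m ->]|[m [u' ->]]]] := lettersP u.
- rewrite (_ : [set _ | _] = setT)//; apply/seteqP; split=> A //= _.
  by rewrite -[letters m]cats0 tree_code_letters.
- rewrite (_ : [set _ | _] = setT)//; apply/seteqP; split=> A //= _.
  by rewrite tree_code_letters.
- rewrite (_ : [set _ | _] = [set A : power2 M2 | A m /\ nilp u']).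
    apply: measurable_set_and; last exact: measurable_set_prop.
    exact: (measurable_coord m true).
  by apply/seteqP; split=> A /=; rewrite tree_code_letters /= cats0 => /andP.
Qed.

Lemma tree_codeP A B : p2_le A B <-> @tree_le bool (tree_code A) (tree_code B).
Proof.
rewrite p2_leP; split.
  move=> [m mAB]; exists (letters m); apply/funext => u.
  by rewrite /subtree_at tree_code_letters (_ : A = fun w => B (m ++ w))//; apply/funext.
move=> [u uAB]; have {}uAB v : tree_code A v = tree_code B (u ++ v) by rewrite uAB.
have [[m uE]|[[m uE]|[m [u' uE]]]] := lettersP u.
- exists m => w; have := uAB (letters w ++ [:: true]).
  by rewrite uE !tree_code_letters /= !cats0 !andbT.
(* Below a midpoint the node 10 is present, completing a letter and starting another; in a coded
   tree nothing extends the leaf 1. *)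
- by have := uAB [:: true; false]; rewrite uE -catA tree_code_letters /= andbF.
(* At or beyond a leaf nothing can be appended, whereas a coded tree contains the node 0. *)
- have := uAB [:: false]; rewrite uE -catA tree_code_letters /=.
  by case: u' {uE} => [|? ?]; rewrite andbF.
Qed.

Lemma p2_le_reducible_tree_le :
  borel_reducible [set: power2 M2] p2_le (Lambda bool) (@tree_le bool).
Proof.
exists tree_code; split; first exact: measurable_tree_code.
  by move=> A _; exact: tree_code_Lambda.
by move=> A B _ _; exact: tree_codeP.
Qed.

(** * The tree order is a countable Borel quasi-order *)

Lemma measurable_Tr (X : countType) : measurable (Tr X).
Proof.
have m (u : seq X) : measurable [set T : power2 (seq X) | T u] by exact: (measurable_coord u true).
apply: measurable_set_and; first exact: measurable_set_exists.
apply: measurable_set_forall => u; apply: measurable_set_forall => v.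
apply: measurable_set_imply; first exact: measurable_set_prop.
exact: measurable_set_imply.
Qed.

Lemma tree_le_countable_borel (R : realType) (X : countType) :
  countable_borel_quasi_order R (Tr X) (@tree_le X).
Proof.
split.
- exact: standard_borel_Tr.
- split=> [T _|T T' T'' _ _ _ [u ->] [v ->]]; first by exists [::].
  by exists (v ++ u); apply/funext => w; rewrite /subtree_at catA.
- have mTr := @measurable_Tr X.
  have m1 (u : seq X) : measurable [set TT : power2 (seq X) * power2 (seq X) | TT.1 u].
    rewrite -[X in measurable X]setTI.
    have /(_ measurableT _ (measurable_coord u true)) :=
      @measurable_fst _ _ (power2 (seq X)) (power2 (seq X)).
    exact.
  have m2 (u : seq X) : measurable [set TT : power2 (seq X) * power2 (seq X) | TT.2 u].
    rewrite -[X in measurable X]setTI.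
    have /(_ measurableT _ (measurable_coord u true)) :=
      @measurable_snd _ _ (power2 (seq X)) (power2 (seq X)).
    exact.
  rewrite (_ : [set _ | _] = [set TT | (Tr X `*` Tr X) TT /\
      exists u : seq X, forall v : seq X, (TT.1 v -> TT.2 (u ++ v)) /\ (TT.2 (u ++ v) -> TT.1 v)]).
    apply: measurable_set_and; first exact: measurableX.
    apply: measurable_set_exists => u; apply: measurable_set_forall => v.
    by apply: measurable_set_and; apply: measurable_set_imply.
  apply/seteqP; split=> -[T T'] /=.
    by move=> [? ? [u TE]]; split; [split|exists u => v; rewrite TE].
  move=> [[? ?] [u uP]]; split=> //; exists u; apply/funext => v.
  by apply/idP/idP; have [] := uP v.
- move=> T _.
  have cr : countable (range (subtree_at T)).
    exact: sub_countable (card_image_le _ _) (countableP _).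
  by apply: sub_countable cr; apply: subset_card_le => _ [_ [u ->]]; exists u.
Qed.

(** * Universality of the order on subsets of the free monoid *)

Section orbit_code.
Variables (T : Type) (g : nat -> T -> T) (bit : T -> nat -> bool).

(* The sequence is 11 0 b_0 0 b_1 0 b_2 ..., in which 11 occurs only at the start. *)
Definition marked_bits (x : T) (j : nat) : bool :=
  if j is j'.+2 then odd j' && bit x j'./2 else true.

(* The word 1^n1 0 1^n2 0 ... 1^nk 0 1^j denotes the j-th marked bit of
   g_nk (... (g_n1 x)). *)
Fixpoint orbit_code (x : T) (j : nat) (u : seq bool) : bool :=
  match u with
  | [::] => marked_bits x j
  | true :: u' => orbit_code x j.+1 u'
  | false :: u' => orbit_code (g j x) 0 u'
  end.

Lemma orbit_code_nseq x j k u :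
  orbit_code x j (nseq k true ++ u) = orbit_code x (j + k) u.
Proof. by elim: k j => [|k IH] j /=; rewrite ?addn0// IH addSnnS. Qed.

(** The code acts like an automaton with states (x, j): reading [u] merely changes the state. *)
Lemma orbit_code_cat (O : set T) x j u : (forall n y, O y -> O (g n y)) -> O x ->
  exists x' j', O x' /\ forall v, orbit_code x j (u ++ v) = orbit_code x' j' v.
Proof.
move=> gO; elim: u x j => [|[] u IH] x j Ox /=; first by exists x, j.
- exact: IH.
- by apply: IH; exact: gO.
Qed.

Lemma marked_bits_shift x y j :
  (forall k, marked_bits y k = marked_bits x (j + k)) -> j = 0%N /\ bit y = bit x.
Proof.
move=> H; suff j0 : j = 0%N.
  (* Bit k sits at place 2k+3. *)
  split=> //; apply/funext => k; have := H (k.*2.+3).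
  by rewrite j0 add0n /= odd_double /= uphalf_double.
have := H 0%N; have := H 1%N; rewrite addn1 addn0 /=.
by case: j {H} => [//|[//|j]] /=; case: (odd j).
Qed.

Lemma orbit_code_eq (O : set T) x y u : (forall n z, O z -> O (g n z)) -> O x ->
  (forall v, orbit_code y 0 v = orbit_code x 0 (u ++ v)) -> exists2 z, O z & bit y = bit z.
Proof.
move=> gO Ox H; have [z [j [Oz zP]]] := @orbit_code_cat O x 0 u gO Ox.
exists z => //; apply: (@marked_bits_shift z y j _).2 => k.
have := H (nseq k true ++ [::]).
by rewrite zP !orbit_code_nseq.
Qed.

End orbit_code.

Lemma standard_borel_coding (R : realType) d (T : measurableType d) (D : set T) :
  standard_borel R D -> exists (e : T -> power2 nat) (k : power2 nat -> T) (S : set (power2 nat)),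
  [/\ measurable_fun setT e, measurable_fun setT k, measurable S,
      forall x, D x -> S (e x) /\ k (e x) = x &
      forall y, S y -> D (k y) /\ e (k y) = y].
Proof.
move=> [mD [P [g [[[S cS dS] cP] [gD ginj gsurj] sE]]]].
have /countable_injP[f finj] := cS.
have [q [qinj qopen qB]] := cantor_coding dS finj cP.
(* The coordinates of [q] are traces of measurable sets of [T], which extends the coding to all of
   [T]. *)
have /choice[M MP] n : exists M : set T, measurable M /\ g @^-1` M = [set p | q p n].
  have : <<s @open P >> [set p | q p n] by apply: sub_sigma_algebra; exact: qopen.
  by rewrite sE => -[M mM]; rewrite setTI => <-; exists M.
pose e (x : T) : power2 nat := fun n => `[< M n x >].
have eg p : e (g p) = q p.
  apply/funext => n; have [_ ME] := MP n.
  have : (g @^-1` M n) p = q p n by rewrite ME.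
  by move=> /= E; apply/asboolP/idP; rewrite E.
(* The inverse is made total by a constant value off the Borel set [range q], which keeps it
   measurable. *)
have /choice[k kP] y : exists t : T, (forall p, y = q p -> t = g p) /\
    ((forall p, y <> q p) -> t = point).
  have [[p ->]|/forallNP np] := pselect (exists p, y = q p).
    exists (g p); split=> [p' /qinj -> //|/(_ p)//].
  by exists point; split=> // p yp; have := np p.
have mr : measurable (range q) by apply: qB; apply: sub_sigma_algebra; exact: openT.
exists e, k, (range q); split.
- apply: measurable_fun_power2 => // n; rewrite setTI.
  rewrite (_ : [set _ | _] = M n); first by have [] := MP n.
  by apply/seteqP; split=> x /asboolP.
- move=> _ B mB; rewrite setTI.
  rewrite (_ : k @^-1` B = q @` (g @^-1` B) `|` (~` range q `&` [set _ | B point])).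
    apply: measurableU.
      by apply: qB; rewrite sE; exists B => //; rewrite setTI.
    by apply: measurableI; [exact: measurableC|exact: measurable_set_prop].
  apply/seteqP; split=> y /=.
    have [[p ->]|/forallNP np] := pselect (exists p, y = q p).
      by rewrite ((kP _).1 p)// => Bp; left; exists p.
    rewrite (kP y).2// => Bp; right; split=> // -[p _ pE]; exact: (np p).
  move=> [[p Bp <-]|[np Bp]]; first by rewrite ((kP _).1 p).
  by rewrite (kP y).2// => p yE; apply: np; exists p.
- exact: mr.
- by move=> x /gsurj[p _ <-]; rewrite eg; split; [exists p|exact: (kP _).1].
- move=> _ [p _ <-]; rewrite ((kP _).1 p)//; split; [exact: gD|exact: eg].
Qed.

Lemma countable_borel_reducible_p2_le (R : realType) d (T : measurableType d) (D : set T)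
    (Q : T -> T -> Prop) :
  countable_borel_quasi_order R D Q -> borel_reducible D Q [set: power2 M2] p2_le.
Proof.
move=> [sD [Qr Qt] mQ cQ].
have mD : measurable D by case: sD.
have [e [k [S [me mk mS De Sk]]]] := standard_borel_coding sD.
pose P := [set ab : power2 nat * power2 nat | (S `*` S) ab /\
  [/\ D (k ab.2), D (k ab.1) & Q (k ab.2) (k ab.1)]].
have mP : measurable P.
  apply: measurable_set_and; first exact: measurableX.
  rewrite -[X in measurable X]setTI.
  have mkk : measurable_fun setT (fun ab : power2 nat * power2 nat => (k ab.2, k ab.1)).
    apply: measurable_fun_pair; apply: measurableT_comp mk _.
      exact: measurable_snd.
    exact: measurable_fst.
  exact: (mkk measurableT _ mQ).
have [a|h [mh hP]] := lusin_novikov mP.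
  have [Sa|nSa] := pselect (S a); last first.
    rewrite (_ : [set _ | _] = set0)//; rewrite -subset0 => b [[/= Sa]].
    by have := nSa Sa.
  have [Dka _] := Sk a Sa.
  have /countable_injP[f finj] := cQ _ Dka.
  apply/countable_injP; exists (f \o k) => b b'; rewrite !inE.
  move=> -[[/= _ Sb] [Db _ Qb]] [[/= _ Sb'] [Db' _ Qb']].
  move=> /finj; rewrite !inE => kE.
  by have [_ <-] := Sk _ Sb; have [_ <-] := Sk _ Sb'; rewrite kE.
pose z n x := k (h n (e x)).
have mz n : measurable_fun setT (z n).
  by apply: measurableT_comp mk _; apply: measurableT_comp (mh n) me.
pose E n := [set x | [/\ D (z n x), D x & Q (z n x) x]].
have mE n : measurable (E n).
  rewrite -[E n]setTI.
  have mzi : measurable_fun setT (fun x => (z n x, x)).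
    by apply: measurable_fun_pair => //; exact: measurable_id.
  exact: (mzi measurableT _ mQ).
(* Where [z n x] is not a predecessor, x itself is returned; by reflexivity [g n] then always yields
   predecessors. *)
pose g n x := if `[< E n x >] then z n x else x.
have gD n x : D x -> D (g n x).
  by move=> Dx; rewrite /g; case: asboolP => // -[].
have gQ n x : D x -> Q (g n x) x.
  by move=> Dx; rewrite /g; case: asboolP => [[]//|_]; exact: Qr.
have mg n : measurable_fun D (g n).
  move=> _ B mB; rewrite (_ : D `&` g n @^-1` B = (E n `&` z n @^-1` B) `|` ((D `\` E n) `&` B)).
    apply: measurableU; apply: measurableI => //; last exact: measurableD.
    rewrite -[X in measurable X]setTI; exact: (mz n).
  apply/seteqP; split=> x /=.
    by rewrite /g; case: asboolP => [Ex [Dx Bx]|nEx [Dx Bx]]; [left|right].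
  rewrite /g => -[[Ex Bx]|[[Dx nEx] Bx]]; last by case: asboolP.
  by case: asboolP => // _; split=> //; case: Ex.
exists (fun x => orbit_code g e x 0); split=> //.
  apply: measurable_fun_power2 => // u.
  suff : forall j, measurable (D `&` [set x | orbit_code g e x j u]) by [].
  elim: u => [|[] u IH] j /=.
  - case: j => [|[|j]] /=; try by rewrite (_ : [set _ | _] = setT) ?setIT//; apply/seteqP; split.
    apply: measurableI => //.
    rewrite (_ : [set _ | _] = [set x | odd j /\ e x j./2]).
      apply: measurable_set_and; first exact: measurable_set_prop.
      rewrite -[X in measurable X]setTI.
      exact: (me measurableT _ (measurable_coord j./2 true)).
    by apply/seteqP; split=> x /= /andP.
  - exact: IH.
  - have := mg j mD _ (IH 0%N); congr measurable.
    apply/seteqP; split=> x /=; first by move=> [? []].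
    by move=> [Dx H]; split=> //; split => //; exact: gD.
move=> x y Dx Dy; rewrite p2_leP; split.
  move=> Qxy; have [|n hE] := hP (e y) (e x).
    have [Sy yE] := De y Dy; have [Sx xE] := De x Dx.
    by split; rewrite /= ?yE ?xE.
  (* The word 1^n 0 is the instruction to apply [g n]. *)
  exists (nseq n true ++ [:: false]) => w.
  rewrite -catA orbit_code_nseq add0n /=.
  suff -> : g n y = x by [].
  have zE : z n y = x by rewrite /z -hE; have [] := De x Dx.
  by rewrite /g; case: asboolP => // -[]; rewrite /E /= zE.
(* The orbit of y stays among its predecessors, so a translate of the code of y can only be the code
   of one of them. *)
move=> [m mE']; have [||w [Dw Qw] xw] := @orbit_code_eq _ g e [set w | D w /\ Q w y] y x m _ _ mE'.
- move=> n w [Dw Qw]; split; first exact: gD.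
  apply: Qt Qw => //; [exact: gD|exact: gQ].
- by split=> //; exact: Qr.
by have [_ <-] := De x Dx; rewrite xw; have [_ ->] := De w Dw.
Qed.

Theorem theorem3p5 (R : realType) :
  borel_reducible [set: power2 M2] p2_le (Lambda bool) (@tree_le bool) /\
  universal_countable_borel_quasi_order R (Tr bool) (@tree_le bool).
Proof.
split; first exact: p2_le_reducible_tree_le.
split; first exact: tree_le_countable_borel.
move=> d T D Q /countable_borel_reducible_p2_le[f [mf _ fP]].
have [t [mt tL tP]] := p2_le_reducible_tree_le.
exists (t \o f); split.
- exact: measurableT_comp.
- by move=> x Dx; have [] := tL (f x) I.
- by move=> x y Dx Dy; rewrite fP// tP.
Qed.
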